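(* Let $\rho$ be a state on a finite-dimensional Hilbert space $\mathcal H$ and $\delta$ a traceless Hermitian operator on $\mathcal H$. Let $\rho'^n$ be states on $\mathcal H^{\otimes n}$ and $\delta'^n$ traceless Hermitian operators on $\mathcal H^{\otimes n}$ such that $\|\rho'^n-\rho^{\otimes n}\|_1\to0$ and $\frac1{\sqrt n}\|\delta'^n-\delta^{(n)}\|_1\to0$. Then \[ \liminf_{n\to\infty}\frac1n\Big(J^S_{\rho'^n}(\delta'^n)-J^S_{\rho^{\otimes n}}(\delta^{(n)})\Big)\ge0,\qquad \liminf_{n\to\infty}\frac1n\Big(J^R_{\rho'^n}(\delta'^n)-J^R_{\rho^{\otimes n}}(\delta^{(n)})\Big)\ge0 . \]
   Context: $\|\cdot\|_1$ is the trace norm. $\delta^{(n)}:=\sum_{k=1}^n\rho^{\otimes(k-1)}\otimes\delta\otimes\rho^{\otimes(n-k)}$. For a state $\sigma$ and traceless Hermitian $\eta$: the SLD Fisher information is $J^S_\sigma(\eta)=\mathrm{tr}\,\sigma L^2$ where $L$ is Hermitian with $\eta=\frac12(L\sigma+\sigma L)$; the RLD Fisher information is $J^R_\sigma(\eta)=\mathrm{tr}\,\sigma L^\dagger L$ where $\eta=L\sigma$ (value $\infty$ if no solution exists).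
   Formalization: Each inequality is asserted only where the Fisher information of the unperturbed pair (ρ^{⊗n}, δ^{(n)}) is finite; where it is +∞ the difference is −∞ or undefined (e.g. ρ pure, δ=σ_x, full-rank ρ'^n, RLD case) and nothing is claimed. *)

(* Defs.v *)
(* Complex scalars: an arbitrary archimedean numeric
   algebraically closed field C. *)
From HB Require Import structures.
From mathcomp Require Import all_boot all_order all_algebra.
From Stdlib Require Import ClassicalEpsilon.
Set Implicit Arguments. Unset Strict Implicit. Unset Printing Implicit Defensive.
Import Order.TTheory GRing.Theory Num.Theory.
Local Open Scope ring_scope.

Section QDefs.
Variable C : numClosedFieldType.

Definition adjmx (m n : nat) (A : 'M[C]_(m, n)) : 'M[C]_(n, m) :=
  \matrix_(i, j) (A j i)^*.

Definition hermitian_mx (n : nat) (A : 'M[C]_n) : Prop := adjmx A = A.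

Definition psd_mx (n : nat) (A : 'M[C]_n) : Prop :=
  hermitian_mx A /\ forall v : 'cV[C]_n, 0 <= (adjmx v *m A *m v) 0 0.

Definition is_state (n : nat) (A : 'M[C]_n) : Prop := psd_mx A /\ \tr A = 1.

Definition traceless_herm (n : nat) (A : 'M[C]_n) : Prop :=
  hermitian_mx A /\ \tr A = 0.

Definition trnorm (n : nat) (A : 'M[C]_n) : C :=
  \tr (epsilon (inhabits 0) (fun P : 'M[C]_n => psd_mx P /\ P *m P = adjmx A *m A)).

Definition kron (m1 n1 m2 n2 : nat) (A : 'M[C]_(m1, n1)) (B : 'M[C]_(m2, n2))
  : 'M[C]_(m1 * m2, n1 * n2) :=
  \matrix_(i < m1 * m2, j < n1 * n2)
    (let ii := enum_val (cast_ord (esym (@mxvec_cast m1 m2)) i) : 'I_m1 * 'I_m2 in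
     let jj := enum_val (cast_ord (esym (@mxvec_cast n1 n2)) j) : 'I_n1 * 'I_n2 in
     A ii.1 jj.1 * B ii.2 jj.2).

Fixpoint tpow (d : nat) (A : 'M[C]_d) (n : nat) : 'M[C]_(d ^ n) :=
  match n return 'M[C]_(d ^ n) with
  | 0 => 1%:M
  | n'.+1 => castmx (esym (expnS d n'), esym (expnS d n')) (kron A (tpow A n'))
  end.

Lemma tens_dim (d n k : nat) : (k < n)%N -> (d ^ k * (d * d ^ (n - k.+1)) = d ^ n)%N.
Proof. by move=> lt; rewrite -expnS -expnD subnSK // subnKC // ltnW. Qed.

Definition deltan (d : nat) (rho delta : 'M[C]_d) (n : nat) : 'M[C]_(d ^ n) :=
  \sum_(k < n)
    castmx (tens_dim d (ltn_ord k), tens_dim d (ltn_ord k))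
      (kron (tpow rho k) (kron delta (tpow rho (n - k.+1)))).

(* Extended nonnegative values: None stands for +infinity. *)
Definition sld_eq (n : nat) (sigma eta L : 'M[C]_n) : Prop :=
  hermitian_mx L /\ eta = 2^-1 *: (L *m sigma + sigma *m L).

Definition JS (n : nat) (sigma eta : 'M[C]_n) : option C :=
  epsilon (inhabits None) (fun o : option C =>
    match o with
    | Some x => exists L, sld_eq sigma eta L /\ x = \tr (sigma *m L *m L)
    | None => ~ exists L, sld_eq sigma eta L
    end).

Definition JR (n : nat) (sigma eta : 'M[C]_n) : option C :=
  epsilon (inhabits None) (fun o : option C =>
    match o with
    | Some x => exists L, eta = L *m sigma /\ x = \tr (sigma *m adjmx L *m L)
    | None => ~ exists L : 'M[C]_n, eta = L *m sigma
    end).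

Definition conv0 (a : nat -> C) : Prop :=
  forall eps : C, 0 < eps -> exists N, forall n, (N <= n)%N -> `|a n| <= eps.

(* liminf_n (1/n) (a_n - b_n) >= 0 for a_n, b_n in [0, +infinity],
   i.e. for every eps > 0, eventually (1/n)(a_n - b_n) >= -eps.
   Convention: +inf - (finite) = +inf; when b_n = +inf the difference is
   undefined and no constraint is imposed. *)
Definition liminf_diff_ge0 (a b : nat -> option C) : Prop :=
  forall eps : C, 0 < eps -> exists N, forall n, (N <= n)%N ->
    match b n with
    | None => True
    | Some y => match a n with
                | None => True
                | Some x => is_true (- eps <= (x - y) / n%:R)
                end
    end.

End QDefs.

(* Main.v *)
Require Import Defs.
From HB Require Import structures.
From mathcomp Require Import all_boot all_order all_algebra.
From mathcomp Require Import ring.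
From Stdlib Require Import ClassicalEpsilon.
Set Implicit Arguments. Unset Strict Implicit. Unset Printing Implicit Defensive.
Import Order.TTheory GRing.Theory Num.Theory.
Local Open Scope ring_scope.

(** Both Fisher informations are maxima of [X |-> 2 Re tr (eta X^H) - tr (X s X^H)],
    over Hermitian [X] (SLD) or over all [X] (RLD), attained at the logarithmic
    derivative [L]. Any [X] thus bounds the information of the perturbed pair from
    below, and by trace norm duality the loss against the unperturbed pair is
    controlled as soon as [X] has operator norm [O(sqrt n)]. We take
    [X = L_n (1 + L_n^H L_n / a)^-1] with [a] of order [n], where [L_n] is the sum
    of the one-site derivatives: it has norm at most [sqrt a / 2], and replacing
    [L_n] by [X] costs at most [tr (s (L_n^H L_n)^2) / 4a]. The one-site derivative
    being centred, this fourth moment is [O(n^2)], so the cost is [O(n^2 / a)].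
    Finally, if [delta^(n)] has a logarithmic derivative [L'] then so does [delta]:
    take the partial trace of [L' (1 (x) rho^(x)(n-1))]. *)

Reserved Notation "A ^H" (at level 8, format "A ^H").
Local Notation "A ^H" := (adjmx A) : ring_scope.

(** * Algebra of the conjugate transpose *)

Section Adjoint.
Variable C : numClosedFieldType.
Implicit Types m n p : nat.

Lemma adjmxE m n (A : 'M[C]_(m, n)) i j : A^H i j = (A j i)^*.
Proof. by rewrite mxE. Qed.

Lemma adjmxK m n (A : 'M[C]_(m, n)) : A^H^H = A.
Proof. by apply/matrixP=> i j; rewrite !mxE conjCK. Qed.

Lemma adjmxM m n p (A : 'M[C]_(m, n)) (B : 'M[C]_(n, p)) :
  (A *m B)^H = B^H *m A^H.
Proof.
apply/matrixP=> i j; rewrite !mxE rmorph_sum; apply: eq_bigr => k _.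
by rewrite !mxE rmorphM mulrC.
Qed.

Lemma adjmxD m n (A B : 'M[C]_(m, n)) : (A + B)^H = A^H + B^H.
Proof. by apply/matrixP=> i j; rewrite !mxE rmorphD. Qed.

Lemma adjmxN m n (A : 'M[C]_(m, n)) : (- A)^H = - A^H.
Proof. by apply/matrixP=> i j; rewrite !mxE rmorphN. Qed.

Lemma adjmxB m n (A B : 'M[C]_(m, n)) : (A - B)^H = A^H - B^H.
Proof. by rewrite adjmxD adjmxN. Qed.

Lemma adjmxZ m n c (A : 'M[C]_(m, n)) : (c *: A)^H = c^* *: A^H.
Proof. by apply/matrixP=> i j; rewrite !mxE rmorphM. Qed.

Lemma adjmx1 n : (1%:M : 'M[C]_n)^H = 1%:M.
Proof. by apply/matrixP=> i j; rewrite !mxE rmorph_nat eq_sym. Qed.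

Lemma mxtrace_adj n (A : 'M[C]_n) : \tr A^H = (\tr A)^*.
Proof. by rewrite /mxtrace rmorph_sum; apply: eq_bigr => i _; rewrite mxE. Qed.

Lemma adjmx_cast m n m' n' (e : m = m') (f : n = n') (A : 'M[C]_(m, n)) :
  (castmx (e, f) A)^H = castmx (f, e) A^H.
Proof. by case: _ / e; case: _ / f; rewrite !castmx_id. Qed.

End Adjoint.

(** * Compatibility of dimension casts with the algebra and the trace *)

Section SquareCast.
Variables (R : comPzRingType) (m n : nat) (e : m = n).

Lemma castmx_sqM (A B : 'M[R]_m) :
  castmx (e, e) (A *m B) = castmx (e, e) A *m castmx (e, e) B.
Proof. by case: _ / e; rewrite !castmx_id. Qed.

Lemma castmx_sqD (A B : 'M[R]_m) :
  castmx (e, e) (A + B) = castmx (e, e) A + castmx (e, e) B.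
Proof. by case: _ / e; rewrite !castmx_id. Qed.

Lemma castmx_sqZ c (A : 'M[R]_m) :
  castmx (e, e) (c *: A) = c *: castmx (e, e) A.
Proof. by case: _ / e; rewrite !castmx_id. Qed.

Lemma mxtrace_cast (A : 'M[R]_m) : \tr (castmx (e, e) A) = \tr A.
Proof. by case: _ / e; rewrite !castmx_id. Qed.

End SquareCast.

(** * Kronecker products, computed on pairs of indices *)

Section Kron.
Variable C : numClosedFieldType.

(** Row-major numbering of pairs. A cast keeps only the numerical value of an index, so
    reassociating Kronecker products rests on this value. *)
Lemma val_mxvec_index m n (i : 'I_m) (j : 'I_n) :
  mxvec_index i j = (i * n + j)%N :> nat.
Proof.
rewrite /mxvec_index /= /enum_rank enum_rank_in.unlock insubdK; last first.
  by rewrite -topredE /= cardE index_mem mem_enum.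
rewrite enumT unlock /= /prod_enum.
have ii : i \in enum 'I_m by rewrite mem_enum.
have jj : j \in enum 'I_n by rewrite mem_enum.
rewrite -[in RHS](index_enum_ord i) -[in RHS](index_enum_ord j).
elim: (enum 'I_m) ii => //= x s IHs; rewrite inE index_cat.
have [-> _|nix] := eqVneq i x.
  by rewrite map_f //= index_map // => u v [].
rewrite orFb => /IHs->; rewrite size_map size_enum_ord.
case: ifP; first by case/mapP=> z _ [/eqP]; rewrite (negPf nix).
by rewrite mulSn addnA.
Qed.

Lemma kronE m1 n1 m2 n2 (A : 'M[C]_(m1, n1)) (B : 'M[C]_(m2, n2)) i j k l :
  kron A B (mxvec_index i j) (mxvec_index k l) = A i k * B j l.
Proof. by rewrite mxE /mxvec_index !cast_ordK !enum_rankK. Qed.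

Lemma sum_mxvec_index m n (F : 'I_(m * n) -> C) :
  \sum_k F k = \sum_i \sum_j F (mxvec_index i j).
Proof.
rewrite pair_big /= (reindex _ (curry_mxvec_bij m n)) /=.
by apply: eq_bigr => -[i j].
Qed.

Lemma kronP m1 n1 m2 n2 (A B : 'M[C]_(m1 * m2, n1 * n2)) :
  (forall i j k l, A (mxvec_index i j) (mxvec_index k l) =
                   B (mxvec_index i j) (mxvec_index k l)) -> A = B.
Proof.
move=> AB; apply/matrixP=> a b.
by case/mxvec_indexP: a => i j; case/mxvec_indexP: b => k l.
Qed.

Lemma kron_mul m1 n1 p1 m2 n2 p2 (A : 'M[C]_(m1, n1)) (B : 'M[C]_(m2, n2))
    (A' : 'M[C]_(n1, p1)) (B' : 'M[C]_(n2, p2)) :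
  kron A B *m kron A' B' = kron (A *m A') (B *m B').
Proof.
apply: kronP => i j k l; rewrite kronE !mxE sum_mxvec_index big_distrlr /=.
by apply: eq_bigr => a _; apply: eq_bigr => b _; rewrite !kronE mulrACA.
Qed.

Lemma adjmx_kron m1 n1 m2 n2 (A : 'M[C]_(m1, n1)) (B : 'M[C]_(m2, n2)) :
  (kron A B)^H = kron A^H B^H.
Proof. by apply: kronP => i j k l; rewrite kronE !adjmxE kronE rmorphM. Qed.

Lemma mxtrace_kron m n (A : 'M[C]_m) (B : 'M[C]_n) :
  \tr (kron A B) = \tr A * \tr B.
Proof.
rewrite /mxtrace sum_mxvec_index big_distrlr /=.
by apply: eq_bigr => a _; apply: eq_bigr => b _; rewrite kronE.
Qed.

Lemma kronDl m1 n1 m2 n2 (A A' : 'M[C]_(m1, n1)) (B : 'M[C]_(m2, n2)) :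
  kron (A + A') B = kron A B + kron A' B.
Proof. by apply: kronP => i j k l; rewrite [RHS]mxE !kronE mxE mulrDl. Qed.

Lemma kronDr m1 n1 m2 n2 (A : 'M[C]_(m1, n1)) (B B' : 'M[C]_(m2, n2)) :
  kron A (B + B') = kron A B + kron A B'.
Proof. by apply: kronP => i j k l; rewrite [RHS]mxE !kronE mxE mulrDr. Qed.

Lemma kron0r m1 n1 m2 n2 (A : 'M[C]_(m1, n1)) :
  kron A (0 : 'M[C]_(m2, n2)) = 0.
Proof. by apply: kronP => i j k l; rewrite [RHS]mxE !kronE mxE mulr0. Qed.

Lemma kronZl m1 n1 m2 n2 c (A : 'M[C]_(m1, n1)) (B : 'M[C]_(m2, n2)) :
  kron (c *: A) B = c *: kron A B.
Proof. by apply: kronP => i j k l; rewrite [RHS]mxE !kronE mxE mulrA. Qed.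

Lemma kronZr m1 n1 m2 n2 c (A : 'M[C]_(m1, n1)) (B : 'M[C]_(m2, n2)) :
  kron A (c *: B) = c *: kron A B.
Proof. by apply: kronP => i j k l; rewrite [RHS]mxE !kronE mxE mulrCA. Qed.

Lemma kron_castl m n m1 n1 m2 n2 (em : m = m1) (en : n = n1)
    (em' : (m * m2 = m1 * m2)%N) (en' : (n * n2 = n1 * n2)%N)
    (A : 'M[C]_(m, n)) (B : 'M[C]_(m2, n2)) :
  kron (castmx (em, en) A) B = castmx (em', en') (kron A B).
Proof.
by case: _ / em em'; case: _ / en en' => *; rewrite !castmx_id.
Qed.

Lemma kron_castr m n m1 n1 m2 n2 (em : m = m2) (en : n = n2)
    (em' : (m1 * m = m1 * m2)%N) (en' : (n1 * n = n1 * n2)%N)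
    (A : 'M[C]_(m1, n1)) (B : 'M[C]_(m, n)) :
  kron A (castmx (em, en) B) = castmx (em', en') (kron A B).
Proof.
by case: _ / em em'; case: _ / en en' => *; rewrite !castmx_id.
Qed.

Lemma kron_id1 m n (e1 : (m = 1 * m)%N) (e2 : (n = 1 * n)%N)
    (B : 'M[C]_(m, n)) :
  kron (1%:M : 'M[C]_1) B = castmx (e1, e2) B.
Proof.
apply: kronP => i j k l; rewrite kronE castmxE !ord1 mxE eqxx mul1r.
by congr (B _ _); apply/esym/ord_inj; exact: val_mxvec_index.
Qed.

Lemma kronA m1 n1 m2 n2 m3 n3 (e1 : (m1 * (m2 * m3) = m1 * m2 * m3)%N)
    (e2 : (n1 * (n2 * n3) = n1 * n2 * n3)%N)
    (A1 : 'M[C]_(m1, n1)) (A2 : 'M[C]_(m2, n2)) (A3 : 'M[C]_(m3, n3)) :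
  kron (kron A1 A2) A3 = castmx (e1, e2) (kron A1 (kron A2 A3)).
Proof.
apply: kronP => i a j b.
case/mxvec_indexP: i => i1 i2; case/mxvec_indexP: j => j1 j2.
have cE m p q (e : (m * (p * q) = m * p * q)%N) u v w :
    cast_ord (esym e) (mxvec_index (mxvec_index u v) w) =
    mxvec_index u (mxvec_index v w).
  apply: ord_inj; apply: (etrans (val_mxvec_index (mxvec_index u v) w)).
  by rewrite !val_mxvec_index mulnDl mulnA addnA.
by rewrite castmxE !cE !kronE mulrA.
Qed.

End Kron.

(** * Recursion on the number of tensor factors *)

Section TensorPowers.
Variables (C : numClosedFieldType) (d : nat).
Implicit Types A B rho delta : 'M[C]_d.

Definition consmx n (M : 'M[C]_(d * d ^ n)) : 'M[C]_(d ^ n.+1) :=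
  castmx (esym (expnS d n), esym (expnS d n)) M.

Lemma tpowS A n : tpow A n.+1 = consmx (kron A (tpow A n)).
Proof. by []. Qed.

(** The term with [delta] on the first site splits off, and the others share the factor [rho] there.
    Inductions on [n] use this recursion in place of the sum with its casts. *)
Lemma deltanS rho delta n :
  deltan rho delta n.+1 =
  consmx (kron delta (tpow rho n) + kron rho (deltan rho delta n)).
Proof.
rewrite /deltan big_ord_recl /consmx castmx_sqD; congr (_ + _).
  rewrite /= (kron_id1 (esym (mul1n _)) (esym (mul1n _))) castmx_comp.
  move: (etrans _ _) (expnS d n); rewrite subn1 /= => e f.
  exact: eq_castmx.
have -> (H : 'I_n -> 'M[C]_(d ^ n)) :
    kron rho (\sum_k H k) = \sum_k kron rho (H k).
  elim/big_rec2: _ => [|k M N _ <-]; first by rewrite kron0r.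
  by rewrite kronDr.
have -> : forall m1 m2 (e : m1 = m2) (G : 'I_n -> 'M[C]_m1),
    castmx (e, e) (\sum_k G k) = \sum_k castmx (e, e) (G k).
  move=> m1 m2 e G; case: _ / e; rewrite castmx_id.
  by apply: eq_bigr => k _; rewrite castmx_id.
apply: eq_bigr => k _ /=.
rewrite (kron_castr _ _ (congr1 (muln d) (tens_dim d (ltn_ord k)))
  (congr1 (muln d) (tens_dim d (ltn_ord k)))).
rewrite (kron_castl _ _ (congr1 (muln^~ _) (esym (expnS d k)))
  (congr1 (muln^~ _) (esym (expnS d k)))).
rewrite (kronA (mulnA _ _ _) (mulnA _ _ _)) !castmx_comp.
exact: eq_castmx.
Qed.

End TensorPowers.

(** * Vector norms, operator bounds and positivity *)

Section Norms.
Variable C : numClosedFieldType.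
Implicit Types m n : nat.

Definition sqnorm n (v : 'cV[C]_n) : C := (v^H *m v) 0 0.

Lemma sqnormE n (v : 'cV[C]_n) : sqnorm v = \sum_i `|v i 0| ^+ 2.
Proof.
by rewrite /sqnorm mxE; apply: eq_bigr => i _; rewrite mxE normCKC.
Qed.

Lemma sqnorm_ge0 n (v : 'cV[C]_n) : 0 <= sqnorm v.
Proof. by rewrite sqnormE sumr_ge0 // => i _; rewrite exprn_ge0. Qed.

Lemma sqnorm_eq0 n (v : 'cV[C]_n) : sqnorm v = 0 -> v = 0.
Proof.
rewrite sqnormE => /eqP; rewrite psumr_eq0 => [/allP v0|i _]; last first.
  by rewrite exprn_ge0.
apply/colP=> i; rewrite mxE; apply/eqP.
by move: (v0 i (mem_index_enum i)); rewrite /= expf_eq0 /= normr_eq0.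
Qed.

Lemma sqnormM m n (A : 'M[C]_(m, n)) v :
  sqnorm (A *m v) = (v^H *m (A^H *m A) *m v) 0 0.
Proof. by rewrite /sqnorm adjmxM !mulmxA. Qed.

Lemma cauchy_schwarz n (u v : 'cV[C]_n) :
  `|(u^H *m v) 0 0| <= sqrtC (sqnorm u) * sqrtC (sqnorm v).
Proof.
have dE (w z : 'cV[C]_n) : (w^H *m z) 0 0 = dotmx w^H z^H.
  rewrite dotmxE; congr ((_ *m _) 0 0).
  by apply/matrixP=> i j; rewrite !mxE conjCK.
by rewrite /sqnorm !dE; apply: CauchySchwarz_sqrt.
Qed.

(** The diagonal entry at [i] is the quadratic form of [s] at the vector [Y^H e_i]. *)
Lemma mxtrace_conj_ge0 n (s Y : 'M[C]_n) : psd_mx s -> 0 <= \tr (Y *m s *m Y^H).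
Proof.
move=> [_ s0]; apply: sumr_ge0 => i _.
have := s0 (Y^H *m delta_mx i 0).
rewrite adjmxM adjmxK !mulmxA.
have -> : (delta_mx i 0 : 'cV[C]_n)^H = delta_mx 0 i.
  by apply/matrixP=> a b; rewrite !mxE rmorph_nat andbC.
by rewrite -!(mulmxA (delta_mx 0 i)) -colE -rowE mxE [X in 0 <= X -> _]mxE.
Qed.

(** For [c >= 0] this says that the operator norm is at most [c]; squaring keeps roots out of the
    algebra. *)
Definition opbound n (c : C) (X : 'M[C]_n) :=
  forall v, sqnorm (X *m v) <= c ^+ 2 * sqnorm v.

Lemma opbound_sqrt n c (X : 'M[C]_n) v : 0 <= c -> opbound c X ->
  sqrtC (sqnorm (X *m v)) <= c * sqrtC (sqnorm v).
Proof.
move=> c0 cX; rewrite -[leRHS]sqrCK ?mulr_ge0 ?sqrtC_ge0 ?sqnorm_ge0 //.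
by rewrite ler_sqrtC ?nnegrE ?exprn_ge0 ?mulr_ge0 ?sqrtC_ge0 ?sqnorm_ge0 //
           exprMn sqrtCK.
Qed.

(** With [z = X^H v], Cauchy-Schwarz gives [|z|^2 = <v, X z> <= c |v| |z|], and [|z|] cancels unless
    it vanishes. *)
Lemma opbound_adj n c (X : 'M[C]_n) : 0 <= c -> opbound c X -> opbound c X^H.
Proof.
move=> c0 cX v; set z := X^H *m v.
have [z0|nz] := eqVneq (sqnorm z) 0.
  by rewrite z0 mulr_ge0 ?exprn_ge0 ?sqnorm_ge0.
have zp : 0 < sqnorm z by rewrite lt0r nz sqnorm_ge0.
have e : sqnorm z = (v^H *m (X *m z)) 0 0.
  by rewrite {1}/sqnorm {1}/z adjmxM adjmxK !mulmxA.
have : sqnorm z <= c * sqrtC (sqnorm v) * sqrtC (sqnorm z).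
  rewrite -{1}(ger0_norm (ltW zp)) {1}e; apply: le_trans (cauchy_schwarz _ _) _.
  rewrite [leRHS]mulrAC [leRHS]mulrC ler_wpM2l ?sqrtC_ge0 ?sqnorm_ge0 //.
  by apply: opbound_sqrt.
rewrite -{1}(sqrtCK (sqnorm z)) expr2 ler_pM2r ?sqrtC_gt0 // => h.
rewrite -(sqrtCK (sqnorm z)) -(sqrtCK (sqnorm v)) -exprMn.
by rewrite lerXn2r ?nnegrE ?mulr_ge0 ?sqrtC_ge0 ?sqnorm_ge0.
Qed.

Lemma opboundM n c e (X Y : 'M[C]_n) : 0 <= c ->
  opbound c X -> opbound e Y -> opbound (c * e) (X *m Y).
Proof.
move=> c0 cX eY v; rewrite -mulmxA exprMn -mulrA.
by apply: le_trans (cX _) _; rewrite ler_wpM2l ?exprn_ge0.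
Qed.

End Norms.

(** * Spectral decomposition and duality for the trace norm *)

Section TraceNorm.
Variables (C : numClosedFieldType) (n : nat).
Implicit Types A P T X : 'M[C]_n.

Lemma hermitian_diag A : hermitian_mx A ->
  exists (U : 'M[C]_n) (D : 'rV[C]_n),
    [/\ U *m U^H = 1%:M, U^H *m U = 1%:M & A = U^H *m diag_mx D *m U].
Proof.
have adjE (B : 'M[C]_n) : B^H = map_mx Num.conj B^T.
  by apply/matrixP=> i j; rewrite !mxE.
move=> hA; exists (spectralmx A), (spectral_diag A).
have UU := spectral_unitarymx A; rewrite !adjE.
have UV : spectralmx A *m map_mx Num.conj (spectralmx A)^T = 1%:M.
  exact/unitarymxP.
split=> //; first exact: mulmx1C.
rewrite -invmx_unitary //; apply/orthomx_spectralP/normalmxP.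
by rewrite -adjE hA.
Qed.

Lemma psd_diag A : psd_mx A ->
  exists (U : 'M[C]_n) (D : 'rV[C]_n),
    [/\ U *m U^H = 1%:M, U^H *m U = 1%:M, A = U^H *m diag_mx D *m U
      & forall i, 0 <= D 0 i].
Proof.
case=> hA pA; have [U [D [UV VU AE]]] := hermitian_diag hA.
exists U, D; split=> // i; have := pA (U^H *m delta_mx i 0).
rewrite AE adjmxM adjmxK !mulmxA -[_ *m U *m U^H]mulmxA UV mulmx1.
rewrite -[_ *m U *m U^H]mulmxA UV mulmx1.
rewrite (_ : (delta_mx i 0)^H = delta_mx 0 i); last first.
  by apply/matrixP=> a b; rewrite !mxE rmorph_nat andbC.
by rewrite -colE -rowE !mxE eqxx mulr1n.
Qed.

Lemma psd_gram T : psd_mx (T^H *m T).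
Proof.
split; first by rewrite /hermitian_mx adjmxM adjmxK.
by move=> v; rewrite -sqnormM sqnorm_ge0.
Qed.

Lemma psd_sqrt_exists A : psd_mx A -> exists P, psd_mx P /\ P *m P = A.
Proof.
move=> /psd_diag[U [D [UV VU -> D0]]].
pose S := map_mx sqrtC D.
exists (U^H *m diag_mx S *m U); split; last first.
  rewrite !mulmxA -[_ *m U *m U^H]mulmxA UV mulmx1 -[_ *m diag_mx S *m diag_mx S]mulmxA.
  congr (_ *m _ *m _); apply/matrixP=> i j; rewrite mul_diag_mx !mxE.
  by rewrite mulrnAr -expr2 sqrtCK.
have Sh : (diag_mx S)^H = diag_mx S.
  apply/matrixP=> i j; rewrite !mxE rmorphMn eq_sym.
  case: eqP => [->|//]; rewrite !mulr1n; apply/CrealP/ger0_real.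
  by rewrite sqrtC_ge0 D0.
split; first by rewrite /hermitian_mx !adjmxM adjmxK Sh mulmxA.
move=> v; rewrite !mulmxA -adjmxM -[_ *m U *m v]mulmxA -mulmxA.
rewrite mul_diag_mx mxE sumr_ge0 // => i _; rewrite !mxE mulrCA -normCKC.
by rewrite mulr_ge0 ?exprn_ge0 // sqrtC_ge0.
Qed.

(** The choice in [trnorm] meets its specification, as the Gram matrix [T^H T] has a positive square
    root. *)
Lemma trnorm_spec T :
  exists P, [/\ psd_mx P, P *m P = T^H *m T & trnorm T = \tr P].
Proof.
have := epsilon_spec (inhabits 0) _ (psd_sqrt_exists (psd_gram T)).
by rewrite /trnorm; set P := epsilon _ _ => -[]; exists P.
Qed.

Lemma trnorm_ge0 T : 0 <= trnorm T.
Proof.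
have [P [pP _ ->]] := trnorm_spec T.
by have := mxtrace_conj_ge0 1%:M pP; rewrite adjmx1 mulmx1 mul1mx.
Qed.

(** The trace is taken in an eigenbasis [u_i] of [P = |T|]. Each term [<X u_i, T u_i>] is at most
    [c |T u_i|], and [|T u_i|^2 = <u_i, P^2 u_i>] is the square of the eigenvalue. *)
Lemma trnorm_duality T X c : 0 <= c -> opbound c X ->
  `|\tr (X^H *m T)| <= c * trnorm T.
Proof.
move=> c0 cX; have [P [/psd_diag[U [D [UV VU PE D0]]] PP ->]] := trnorm_spec T.
have -> : \tr P = \sum_i D 0 i.
  by rewrite PE mxtrace_mulC mulmxA UV mul1mx mxtrace_diag.
have -> : \tr (X^H *m T) = \tr ((X *m U^H)^H *m (T *m U^H)).
  by rewrite adjmxM adjmxK -[in RHS]mulmxA [RHS]mxtrace_mulC -!mulmxA VU mulmx1.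
rewrite mulr_sumr; apply: le_trans (ler_norm_sum _ _ _) _; apply: ler_sum => i _.
have col_mul (Y Z : 'M[C]_n) : col i (Y *m Z) = Y *m col i Z.
  by rewrite !colE mulmxA.
have -> : ((X *m U^H)^H *m (T *m U^H)) i i =
    ((X *m col i U^H)^H *m (T *m col i U^H)) 0 0.
  by rewrite -!col_mul !mxE; apply: eq_bigr => j _; rewrite !mxE.
apply: le_trans (cauchy_schwarz _ _) _.
have u1 : sqnorm (col i U^H) = 1.
  have /matrixP/(_ i i) := UV; rewrite !mxE eqxx mulr1n => <-.
  by rewrite /sqnorm mxE; apply: eq_bigr => j _; rewrite !mxE conjCK.
have Pu : P *m col i U^H = D 0 i *: col i U^H.
  rewrite -col_mul PE -!mulmxA UV mulmx1.
  by apply/colP=> k; rewrite mxE mul_mx_diag !mxE mulrC.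
apply: ler_pM; rewrite ?sqrtC_ge0 ?sqnorm_ge0 //.
  by apply: le_trans (opbound_sqrt _ _ cX) _; rewrite // u1 sqrtC1 mulr1.
rewrite sqnormM -PP.
have -> : ((col i U^H)^H *m (P *m P) *m col i U^H) 0 0 = D 0 i ^+ 2 * sqnorm (col i U^H).
  by rewrite -!mulmxA Pu -scalemxAr Pu -!scalemxAr mxE [X in _ * X]mxE mulrA.
by rewrite u1 mulr1 sqrCK.
Qed.

Lemma trnorm_duality2 T X c : 0 <= c -> opbound c X ->
  `|\tr (X *m T *m X^H)| <= c ^+ 2 * trnorm T.
Proof.
move=> c0 cX; rewrite mxtrace_mulC mulmxA.
have -> : X^H *m X = (X^H *m X)^H by rewrite adjmxM adjmxK.
apply: trnorm_duality; first by rewrite exprn_ge0.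
by rewrite expr2; apply: opboundM => //; apply: opbound_adj.
Qed.

End TraceNorm.

(** * The regularised derivative [L (1 + L^H L / a)^-1] *)

Section Truncation.
Variables (C : numClosedFieldType) (n : nat) (a : C) (L : 'M[C]_n).
Hypothesis a_gt0 : 0 < a.

Let B := L^H *m L.
Let M := 1%:M + a^-1 *: B.
Let G := invmx M.

Definition trunc := L *m G.

Let a_neq0 : a != 0. Proof. by rewrite gt_eqF. Qed.

Let aVC : (a^-1)^* = a^-1.
Proof. by apply/CrealP/ger0_real; rewrite invr_ge0 ltW. Qed.

Let B_herm : B^H = B. Proof. by rewrite adjmxM adjmxK. Qed.

(** A row [u] of the kernel satisfies [0 = u M u^H = |u^H|^2 + |L u^H|^2 / a], a sum of nonnegative
    terms. *)
Let M_unit : M \in unitmx.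
Proof.
rewrite -row_free_unit -kermx_eq0; apply/eqP/row_matrixP => i; rewrite row0.
set u := row i _.
have uM : u *m M = 0 by apply/sub_kermxP/row_sub.
rewrite -[u]adjmxK; suff -> : u^H = 0.
  by apply/matrixP=> k l; rewrite !mxE rmorph0.
apply: sqnorm_eq0; apply/eqP; rewrite eq_le sqnorm_ge0 andbT.
have : (u *m M *m u^H) 0 0 = 0 by rewrite uM mul0mx mxE.
rewrite /M mulmxDr mulmx1 -scalemxAr mulmxDl -scalemxAl mxE [X in _ + X]mxE.
have -> : (u *m u^H) 0 0 = sqnorm u^H by rewrite /sqnorm adjmxK.
have -> : (u *m B *m u^H) 0 0 = sqnorm (L *m u^H) by rewrite sqnormM adjmxK.
move=> /eqP; rewrite addr_eq0 => /eqP->.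
by rewrite oppr_le0 mulr_ge0 ?sqnorm_ge0 // invr_ge0 ltW.
Qed.

Let G_herm : G^H = G.
Proof.
have MH : M^H = M by rewrite adjmxD adjmx1 adjmxZ aVC B_herm.
have := congr1 (@adjmx C n n) (mulmxV M_unit); rewrite adjmxM adjmx1 MH.
by move=> /(congr1 (mulmx^~ G)); rewrite mul1mx -mulmxA mulmxV // mulmx1.
Qed.

Let BG : B *m G = a *: (1%:M - G).
Proof.
have := mulmxV M_unit; rewrite {1}/M mulmxDl mul1mx -scalemxAl -/G => e.
by rewrite -e addrAC subrr add0r scalerA divff // scale1r.
Qed.

Let GB : G *m B = a *: (1%:M - G).
Proof.
have aC : a^* = a by apply/CrealP/ger0_real/ltW.
have := congr1 (@adjmx C n n) BG.
by rewrite adjmxM adjmxZ adjmxB adjmx1 B_herm G_herm aC.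
Qed.

(** Completes the square: [4 G (1 - G) = 1 - W^2]. Expressions in [G (1 - G)] are then bounded by
    dropping the square of a Hermitian matrix. *)
Let W := 1%:M - 2 *: G.

Let W_herm : W^H = W.
Proof. by rewrite adjmxB adjmx1 adjmxZ G_herm rmorph_nat. Qed.

Let WW : W *m W = 1%:M - 4 *: (G *m (1%:M - G)).
Proof.
rewrite /W !(mulmxBl, mulmxBr) !(mul1mx, mulmx1) -!(scalemxAl, scalemxAr).
move: (G *m G) => GG; apply/matrixP=> i j; rewrite !mxE; ring.
Qed.

Let truncE2 : trunc^H *m trunc = (a / 4) *: (1%:M - W *m W).
Proof.
rewrite /trunc adjmxM G_herm mulmxA -(mulmxA G) -/B -mulmxA BG WW.
rewrite -scalemxAr subKr scalerA; by congr (_ *: _); field.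
Qed.

(** The left side is [(1 - G) B (1 - G)]. Since [G B = a (1 - G)], it equals [B G (1 - G) B / a],
    where [W] completes the square. *)
Let truncE4 : (L - trunc)^H *m (L - trunc) =
  (4 * a)^-1 *: (B *m B - (W *m B)^H *m (W *m B)).
Proof.
have -> : L - trunc = L *m (1%:M - G) by rewrite mulmxBr mulmx1.
rewrite adjmxM adjmxB adjmx1 G_herm mulmxA -(mulmxA _ L^H) -/B.
rewrite adjmxM W_herm B_herm -[B *m W *m _]mulmxA [W *m (W *m B)]mulmxA WW.
have -> : (1%:M - G) *m B = B *m (1%:M - G).
  by rewrite mulmxBl mulmxBr mul1mx mulmx1 BG GB.
have -> : B *m B - B *m ((1%:M - 4 *: (G *m (1%:M - G))) *m B) =
   4 *: (B *m (1%:M - G) *m (G *m B)).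
  rewrite mulmxBl mul1mx mulmxBr subKr -scalemxAl -scalemxAr.
  have GG : G *m (1%:M - G) = (1%:M - G) *m G.
    by rewrite mulmxBl mulmxBr mul1mx mulmx1.
  by rewrite GG !mulmxA.
rewrite GB -scalemxAr !scalerA; rewrite (_ : _ * _ = 1) ?scale1r //.
by field; rewrite ?a_neq0.
Qed.

Lemma trunc_bound c : c ^+ 2 = a / 4 -> opbound c trunc.
Proof.
move=> cE v; rewrite cE sqnormM truncE2 -{1}W_herm.
rewrite -scalemxAr -scalemxAl mxE ler_wpM2l ?divr_ge0 ?(ltW a_gt0) //.
rewrite mulmxBr mulmxBl mulmx1 mxE [X in _ + X]mxE -sqnormM.
by rewrite lerBlDr lerDl sqnorm_ge0.
Qed.

(** Up to the factor [1 / 4a], the dropped term is [tr (W B s (W B)^H)], nonnegative because [s]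
    is. *)
Lemma trunc_error s : psd_mx s ->
  \tr ((L - trunc) *m s *m (L - trunc)^H) <=
  (4 * a)^-1 * \tr (s *m (L^H *m L *m (L^H *m L))).
Proof.
move=> ps; rewrite mxtrace_mulC [in leLHS]mulmxA truncE4 mxtrace_mulC -scalemxAr mxtraceZ.
rewrite ler_wpM2l ?invr_ge0 ?mulr_ge0 ?(ltW a_gt0) // mulmxBr raddfB /= -/B.
rewrite lerBlDr lerDl mxtrace_mulC -mulmxA mxtrace_mulC.
exact: mxtrace_conj_ge0.
Qed.

(** A Hermitian [L] commutes with [M = 1 + L^2 / a], hence with [G]. The symmetric case admits only
    Hermitian test matrices. *)
Lemma trunc_herm : hermitian_mx L -> hermitian_mx trunc.
Proof.
move=> LH; rewrite /hermitian_mx /trunc adjmxM G_herm LH.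
have LB : L *m B = B *m L by rewrite /B LH mulmxA.
have LM : L *m M = M *m L.
  by rewrite mulmxDr mulmxDl mulmx1 mul1mx -scalemxAl -scalemxAr LB.
have := congr1 (fun Z => G *m Z *m G) LM.
by rewrite /= !mulmxA mulVmx // mul1mx -!mulmxA mulmxV // mulmx1.
Qed.

End Truncation.

(** * Logarithmic derivatives and the perturbation inequality *)

Section Score.
Variables (C : numClosedFieldType) (n : nat).
Implicit Types (P : 'M[C]_n -> Prop) (s eta L X : 'M[C]_n).

(* The logarithmic derivatives in variational form: with [P] the Hermitian
   matrices one gets the symmetric one, with [P] trivial the right one. *)
Definition score P s eta L := P L /\ forall X, P X ->
  \tr (X *m s *m L^H) + \tr (L *m s *m X^H) = \tr (X *m eta) + \tr (eta *m X^H).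

Lemma sld_score s eta L : sld_eq s eta L -> score (@hermitian_mx C n) s eta L.
Proof.
move=> [LH ->]; split=> // X XH; rewrite LH XH.
rewrite -scalemxAl -scalemxAr !mxtraceZ mulmxDr mulmxDl !raddfD /=.
rewrite !mulmxA [\tr (s *m L *m X)]mxtrace_mulC mulmxA.
rewrite [\tr (X *m L *m s)]mxtrace_mulC mulmxA [\tr (s *m X *m L)]mxtrace_mulC mulmxA.
rewrite -[\tr (L *m s *m X)]mxtrace_mulC; field=> //.
Qed.

(** The second terms agree by the equation, the first ones by its adjoint, [s] and [eta] being
    Hermitian. *)
Lemma rld_score s eta L : hermitian_mx s -> hermitian_mx eta ->
  eta = L *m s -> score (fun=> True) s eta L.
Proof.
move=> sH eH e; split=> // X _; rewrite -e; congr (_ + _).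
by rewrite -mulmxA -{1}sH -adjmxM -e eH.
Qed.

(** Testing each relation at the other derivative gives the same cross terms, which thus equal twice
    either trace. The derivative picked by the choice operator can so be exchanged for an explicit
    one. *)
Lemma score_unique P s eta L L' : score P s eta L -> score P s eta L' ->
  \tr (L *m s *m L^H) = \tr (L' *m s *m L'^H).
Proof.
move=> [PL sL] [PL' sL'].
have e1 := sL L PL; have e2 := sL' L PL; have e3 := sL L' PL'; have e4 := sL' L' PL'.
have : 2 * \tr (L *m s *m L^H) = 2 * \tr (L' *m s *m L'^H).
  by rewrite !mulr_natl !mulr2n e1 e4 -e2 -e3 addrC.
by apply: mulfI; rewrite pnatr_eq0.
Qed.

(** Excluded middle shows that the choice meets its specification. The value is put in the form
    [tr (L s L^H)], common to both informations. *)
Lemma JS_some s eta x : JS s eta = Some x ->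
  exists L, sld_eq s eta L /\ x = \tr (L *m s *m L^H).
Proof.
rewrite /JS; set Q := (X in epsilon _ X) => e.
have : exists o, Q o.
  have [[L sL]|nL] := excluded_middle_informative (exists L, sld_eq s eta L).
    by exists (Some (\tr (s *m L *m L))), L.
  by exists None.
move=> /(epsilon_spec (inhabits None)); rewrite e => -[L [[LH sL] ->]].
by exists L; split=> //; rewrite LH mxtrace_mulC mulmxA.
Qed.

Lemma JR_some s eta x : JR s eta = Some x ->
  exists L, eta = L *m s /\ x = \tr (L *m s *m L^H).
Proof.
rewrite /JR; set Q := (X in epsilon _ X) => e.
have : exists o, Q o.
  have [[L sL]|nL] := excluded_middle_informative (exists L, eta = L *m s).
    by exists (Some (\tr (s *m L^H *m L))), L.
  by exists None.
move=> /(epsilon_spec (inhabits None)); rewrite e => -[L [sL ->]].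
by exists L; split=> //; rewrite mxtrace_mulC mulmxA.
Qed.

(** The square of [L' - X] under [s'] bounds the perturbed information from below, and the
    truncation error bounds the other from above. The terms in [X] differ by
    [2 Re tr ((eta' - eta) X^H)] and [tr (X (s' - s) X^H)], which duality controls. *)
Lemma score_perturb P s eta s' eta' L L' c :
    (forall a, 0 < a -> P (trunc a L)) -> 0 < c ->
    psd_mx s -> psd_mx s' -> hermitian_mx eta -> hermitian_mx eta' ->
    score P s eta L -> score P s' eta' L' ->
  \tr (L *m s *m L^H) - \tr (L' *m s' *m L'^H) <=
    2 * c * trnorm (eta' - eta) + c ^+ 2 * trnorm (s' - s)
    + (16 * c ^+ 2)^-1 * \tr (s *m (L^H *m L *m (L^H *m L))).
Proof.
move=> PX c0 ps ps' eH eH' [_ sL] [_ sL'].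
(* With this [a] the truncation has norm at most [sqrt a / 2 = c], and the error factor [1 / 4a] is
   [1 / 16 c^2]. *)
pose a := 4 * c ^+ 2; have a0 : 0 < a by rewrite mulr_gt0 ?exprn_gt0 ?ltr0n.
have {}PX := PX a a0.
have := trunc_error L a0 ps; set X := trunc a L in PX *.
have cX : opbound c X by apply: trunc_bound => //; rewrite /a; field.
rewrite (_ : 4 * a = 16 * c ^+ 2); last by rewrite /a mulrA -natrM.
set K := _ * \tr _ => E; clearbody X.
have F := mxtrace_conj_ge0 (L' - X) ps'.
have expand (Y t : 'M[C]_n) : \tr ((Y - X) *m t *m (Y - X)^H) =
    \tr (Y *m t *m Y^H) - (\tr (X *m t *m Y^H) + \tr (Y *m t *m X^H))
    + \tr (X *m t *m X^H).
  rewrite adjmxB !(mulmxBl, mulmxBr) !raddfB /=; ring.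
rewrite expand sL // in E; rewrite expand sL' // in F.
pose Z := \tr ((eta' - eta) *m X^H); pose R := \tr (X *m (s' - s) *m X^H).
have ZE : \tr (X *m (eta' - eta)) = Z^*.
  by rewrite -mxtrace_adj adjmxM adjmxK adjmxB eH eH'.
have Zb : `|Z| <= c * trnorm (eta' - eta).
  by rewrite /Z mxtrace_mulC; apply: trnorm_duality (ltW c0) cX.
have Rb : R <= c ^+ 2 * trnorm (s' - s).
  apply: le_trans (trnorm_duality2 _ (ltW c0) cX); apply: real_ler_norm.
  apply/CrealP; rewrite -mxtrace_adj !adjmxM adjmxK adjmxB.
  by rewrite (proj1 ps) (proj1 ps') mulmxA.
have Zr : - (Z + Z^*) <= 2 * (c * trnorm (eta' - eta)).
  apply: le_trans (real_ler_norm _) _.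
    by rewrite rpredN; apply/CrealP; rewrite rmorphD /= conjCK addrC.
  rewrite normrN; apply: le_trans (ler_normD _ _) _.
  by rewrite norm_conjC -mulr2n -[leLHS]mulr_natl ler_pM2l // ltr0n.
have RE : R = \tr (X *m s' *m X^H) - \tr (X *m s *m X^H).
  by rewrite /R mulmxBr mulmxBl raddfB.
have ZZ : Z + Z^* = (\tr (X *m eta') + \tr (eta' *m X^H)) -
   (\tr (X *m eta) + \tr (eta *m X^H)).
  rewrite -ZE /Z mulmxBr mulmxBl !raddfB /=; ring.
rewrite -(mulrA 2 c); apply: le_trans (lerD (lerD Zr Rb) E).
(* The left sides of the three bounds add up to that of the goal plus the nonnegative quantity in
   [F]. *)
rewrite -subr_ge0; apply: le_trans F _; rewrite ZZ RE le_eqVlt; apply/orP; left.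
by apply/eqP; ring.
Qed.

End Score.

(** * Partial trace over the second tensor factor *)

Section PartialTrace.
Variables (C : numClosedFieldType) (p q : nat).
Implicit Types (A : 'M[C]_p) (B : 'M[C]_q) (M N : 'M[C]_(p * q)).

Definition ptrace2 M : 'M[C]_p :=
  \matrix_(i, k) \sum_j M (mxvec_index i j) (mxvec_index k j).

Lemma ptrace2_kron A B : ptrace2 (kron A B) = \tr B *: A.
Proof.
apply/matrixP=> i k; rewrite !mxE mulr_suml; apply: eq_bigr => j _.
by rewrite kronE mulrC.
Qed.

Lemma ptrace2D M N : ptrace2 (M + N) = ptrace2 M + ptrace2 N.
Proof.
apply/matrixP=> i k; rewrite !mxE -big_split; apply: eq_bigr => j _.
by rewrite mxE.
Qed.

Lemma ptrace2Z c M : ptrace2 (c *: M) = c *: ptrace2 M.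
Proof.
apply/matrixP=> i k; rewrite !mxE mulr_sumr; apply: eq_bigr => j _.
by rewrite mxE.
Qed.

Lemma ptrace2_adj M : ptrace2 M^H = (ptrace2 M)^H.
Proof.
apply/matrixP=> i k; rewrite !mxE rmorph_sum; apply: eq_bigr => j _.
by rewrite mxE.
Qed.

Lemma ptrace2_mulr M A : ptrace2 (M *m kron A 1%:M) = ptrace2 M *m A.
Proof.
apply/matrixP=> i k; rewrite !mxE.
under [RHS]eq_bigr do rewrite mxE mulr_suml.
rewrite [RHS]exchange_big; apply: eq_bigr => j _; rewrite mxE sum_mxvec_index.
apply: eq_bigr => a _; rewrite (bigD1 j) //= big1 => [|b bj].
  by rewrite kronE mxE eqxx mulr1 addr0.
by rewrite kronE !mxE (negPf bj) !mulr0.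
Qed.

Lemma ptrace2_mull M A : ptrace2 (kron A 1%:M *m M) = A *m ptrace2 M.
Proof.
by rewrite -[LHS]adjmxK -ptrace2_adj adjmxM adjmx_kron adjmx1 ptrace2_mulr
           ptrace2_adj adjmxM !adjmxK.
Qed.

Lemma ptrace2_cyclic M B : ptrace2 (M *m kron 1%:M B) = ptrace2 (kron 1%:M B *m M).
Proof.
apply/matrixP=> i k; rewrite !mxE.
transitivity (\sum_j \sum_b M (mxvec_index i j) (mxvec_index k b) * B b j).
  apply: eq_bigr => j _; rewrite mxE sum_mxvec_index (bigD1 k) //=.
  rewrite [X in _ + X]big1 ?addr0 => [|a ak].
    by apply: eq_bigr => b _; rewrite kronE mxE eqxx mul1r.
  by apply: big1 => b _; rewrite kronE !mxE (negPf ak) mul0r mulr0.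
rewrite exchange_big; apply: eq_bigr => j _; rewrite mxE sum_mxvec_index.
rewrite (bigD1 i) //= [X in _ + X]big1 ?addr0 => [|a ai].
  by apply: eq_bigr => b _; rewrite kronE mxE eqxx mul1r mulrC.
by apply: big1 => b _; rewrite kronE !mxE eq_sym (negPf ai) !mul0r.
Qed.

Lemma ptrace2_right_mul M A B :
  ptrace2 (M *m kron A B) = ptrace2 (M *m kron 1%:M B) *m A.
Proof. by rewrite -ptrace2_mulr -mulmxA kron_mul mul1mx mulmx1. Qed.

(** Cyclicity on the traced factor produces the same matrix as for multiplication on the right, so
    both halves of the symmetric equation reduce to one derivative. *)
Lemma ptrace2_left_mul M A B :
  ptrace2 (kron A B *m M) = A *m ptrace2 (M *m kron 1%:M B).
Proof. by rewrite ptrace2_cyclic -ptrace2_mull mulmxA kron_mul mul1mx mulmx1. Qed.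

End PartialTrace.

(** * Moments of [A (x) 1 + 1 (x) B] in [s (x) t] *)

Section BipartiteMoments.
Variables (C : numClosedFieldType) (p q : nat) (s : 'M[C]_p) (t : 'M[C]_q).
Hypotheses (s1 : \tr s = 1) (t1 : \tr t = 1).

Lemma bipartite_moment1 (A : 'M[C]_p) (B : 'M[C]_q) :
  \tr (kron s t *m (kron A 1%:M + kron 1%:M B)) = \tr (s *m A) + \tr (t *m B).
Proof.
by rewrite mulmxDr !kron_mul !mulmx1 raddfD /= !mxtrace_kron s1 t1 mulr1 mul1r.
Qed.

Lemma bipartite_mul (A1 A2 : 'M[C]_p) (B1 B2 : 'M[C]_q) :
  (kron A1 1%:M + kron 1%:M B1) *m (kron A2 1%:M + kron 1%:M B2) =
  kron (A1 *m A2) 1%:M + kron A1 B2 + (kron A2 B1 + kron 1%:M (B1 *m B2)).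
Proof. by rewrite mulmxDl !mulmxDr !kron_mul !(mul1mx, mulmx1). Qed.

Lemma bipartite_moment2 (A1 A2 : 'M[C]_p) (B1 B2 : 'M[C]_q) :
    \tr (s *m A1) = 0 -> \tr (s *m A2) = 0 ->
  \tr (kron s t *m ((kron A1 1%:M + kron 1%:M B1) *m
                    (kron A2 1%:M + kron 1%:M B2))) =
  \tr (s *m (A1 *m A2)) + \tr (t *m (B1 *m B2)).
Proof.
move=> a1 a2; rewrite bipartite_mul !mulmxDr !kron_mul !mulmx1 !raddfD /=.
by rewrite !mxtrace_kron a1 a2 s1 t1 !mul0r mulr1 mul1r addr0 add0r.
Qed.

(** Of the sixteen terms, those with a single [A] or a single [B] vanish by centring. The two pure
    ones and the six splittings into pairs remain. *)
Lemma bipartite_moment4 (A1 A2 A3 A4 : 'M[C]_p) (B1 B2 B3 B4 : 'M[C]_q) :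
    \tr (s *m A1) = 0 -> \tr (s *m A2) = 0 ->
    \tr (s *m A3) = 0 -> \tr (s *m A4) = 0 ->
    \tr (t *m B1) = 0 -> \tr (t *m B2) = 0 ->
    \tr (t *m B3) = 0 -> \tr (t *m B4) = 0 ->
  \tr (kron s t *m ((kron A1 1%:M + kron 1%:M B1) *m
                    (kron A2 1%:M + kron 1%:M B2) *m
                    ((kron A3 1%:M + kron 1%:M B3) *m
                    (kron A4 1%:M + kron 1%:M B4)))) =
  \tr (s *m (A1 *m A2 *m (A3 *m A4))) + \tr (t *m (B1 *m B2 *m (B3 *m B4)))
  + (\tr (s *m (A1 *m A2)) * \tr (t *m (B3 *m B4))
   + \tr (s *m (A1 *m A3)) * \tr (t *m (B2 *m B4))
   + \tr (s *m (A1 *m A4)) * \tr (t *m (B2 *m B3))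
   + \tr (s *m (A2 *m A3)) * \tr (t *m (B1 *m B4))
   + \tr (s *m (A2 *m A4)) * \tr (t *m (B1 *m B3))
   + \tr (s *m (A3 *m A4)) * \tr (t *m (B1 *m B2))).
Proof.
move=> a1 a2 a3 a4 b1 b2 b3 b4; rewrite !bipartite_mul.
rewrite !(mulmxDl, mulmxDr) !kron_mul !(mulmx1, mul1mx) !raddfD /= !mxtrace_kron.
rewrite a1 a2 a3 a4 b1 b2 b3 b4 s1 t1; ring.
Qed.

End BipartiteMoments.

(** * Sums of one-site operators: derivatives and moments *)

Section TensorSums.
Variables (C : numClosedFieldType) (d : nat).
Implicit Types A L rho delta : 'M[C]_d.
Implicit Types n : nat.

Lemma consmxM n (M N : 'M[C]_(d * d ^ n)) : consmx M *m consmx N = consmx (M *m N).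
Proof. by rewrite /consmx castmx_sqM. Qed.

Lemma consmxD n (M N : 'M[C]_(d * d ^ n)) : consmx M + consmx N = consmx (M + N).
Proof. by rewrite /consmx castmx_sqD. Qed.

Lemma consmxZ n c (M : 'M[C]_(d * d ^ n)) : c *: consmx M = consmx (c *: M).
Proof. by rewrite /consmx castmx_sqZ. Qed.

Lemma consmx_adj n (M : 'M[C]_(d * d ^ n)) : (consmx M)^H = consmx M^H.
Proof. exact: adjmx_cast. Qed.

Lemma mxtrace_consmx n (M : 'M[C]_(d * d ^ n)) : \tr (consmx M) = \tr M.
Proof. exact: mxtrace_cast. Qed.

Lemma consmx_inj n : injective (@consmx C d n).
Proof. exact: can_inj (castmxK _ _). Qed.

Lemma consmx_surj n (M : 'M[C]_(d ^ n.+1)) : exists N, M = consmx N.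
Proof.
exists (castmx (expnS d n, expnS d n) M).
by rewrite /consmx castmx_comp castmx_id.
Qed.

(** The collective operator: [A] at one site and the identity elsewhere, summed over the sites. The
    recursion matches those of [tpow] and [deltanS]. *)
Fixpoint tsum A n : 'M[C]_(d ^ n) :=
  if n is n'.+1 then consmx (kron A 1%:M + kron 1%:M (tsum A n')) else 0.

Lemma tsumS A n : tsum A n.+1 = consmx (kron A 1%:M + kron 1%:M (tsum A n)).
Proof. by []. Qed.

Lemma tsum_adj A n : (tsum A n)^H = tsum A^H n.
Proof.
elim: n => [|n IHn]; first by apply/matrixP=> i j; rewrite !mxE rmorph0.
by rewrite !tsumS consmx_adj adjmxD !adjmx_kron !adjmx1 IHn.
Qed.

Lemma mxtrace_tpow rho n : \tr rho = 1 -> \tr (tpow rho n) = 1.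
Proof.
move=> r1; elim: n => [|n IHn]; first by rewrite /= mxtrace1.
by rewrite tpowS mxtrace_consmx mxtrace_kron r1 IHn mulr1.
Qed.

Lemma mxtrace_deltan rho delta n : \tr rho = 1 -> \tr delta = 0 ->
  \tr (deltan rho delta n) = 0.
Proof.
move=> r1 d0; elim: n => [|n IHn]; first by rewrite /deltan big_ord0 raddf0.
by rewrite deltanS mxtrace_consmx raddfD /= !mxtrace_kron d0 IHn mul0r mulr0 addr0.
Qed.

(** Positivity is carried through the induction as a Gram form [P^H P], which tensor products
    preserve. *)
Lemma psd_tpow rho n : psd_mx rho -> psd_mx (tpow rho n).
Proof.
move=> pr; suff [P ->] : exists P : 'M[C]_(d ^ n), tpow rho n = P^H *m P.
  exact: psd_gram.
have [Q [[QH _] <-]] := psd_sqrt_exists pr.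
elim: n => [|n [P IHn]]; first by exists 1%:M; rewrite /= adjmx1 mulmx1.
exists (consmx (kron Q P)).
by rewrite tpowS IHn consmx_adj consmxM adjmx_kron kron_mul QH.
Qed.

Lemma hermitian_deltan rho delta n : psd_mx rho -> hermitian_mx delta ->
  hermitian_mx (deltan rho delta n).
Proof.
move=> pr dH; rewrite /hermitian_mx; elim: n => [|n IHn].
  by rewrite /deltan big_ord0; apply/matrixP=> i j; rewrite !mxE rmorph0.
rewrite deltanS consmx_adj adjmxD !adjmx_kron IHn dH (proj1 pr).
by rewrite (proj1 (psd_tpow n pr)).
Qed.

Lemma rld_tsum rho delta L n : delta = L *m rho ->
  deltan rho delta n = tsum L n *m tpow rho n.
Proof.
move=> dE; elim: n => [|n IHn]; first by rewrite /deltan big_ord0 mul0mx.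
by rewrite deltanS tsumS tpowS consmxM mulmxDl !kron_mul !mul1mx IHn -dE.
Qed.

Lemma sld_tsum rho delta L n : sld_eq rho delta L ->
  sld_eq (tpow rho n) (deltan rho delta n) (tsum L n).
Proof.
move=> [LH dE]; split; first by rewrite /hermitian_mx tsum_adj LH.
elim: n => [|n IHn].
  by rewrite /deltan big_ord0 mul0mx mulmx0 addr0 scaler0.
rewrite deltanS tsumS tpowS !consmxM consmxD consmxZ; congr (consmx _).
rewrite mulmxDl mulmxDr !kron_mul !mul1mx !mulmx1 IHn {1}dE.
rewrite kronZl kronZr -scalerDr; congr (_ *: _).
by rewrite kronDl kronDr addrACA.
Qed.

(** Tracing out all sites but the first leaves [delta] on the left, as [tpow rho n] has trace one
    and [deltan rho delta n] trace zero, and a multiple of [rho] by a matrix on the right. *)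
Lemma rld_of_tensor rho delta n (L' : 'M[C]_(d ^ n.+1)) : \tr rho = 1 -> \tr delta = 0 ->
  deltan rho delta n.+1 = L' *m tpow rho n.+1 ->
  exists L, delta = L *m rho.
Proof.
move=> r1 d0; have [M ->] := consmx_surj L'.
rewrite deltanS tpowS consmxM => /consmx_inj/(congr1 (@ptrace2 C d _)).
rewrite ptrace2D !ptrace2_kron mxtrace_tpow // mxtrace_deltan //.
by rewrite scale1r scale0r addr0 ptrace2_right_mul => e;
  exists (ptrace2 (M *m kron 1%:M (tpow rho n))).
Qed.

Lemma sld_of_tensor rho delta n (L' : 'M[C]_(d ^ n.+1)) :
  psd_mx rho -> \tr rho = 1 -> \tr delta = 0 ->
  sld_eq (tpow rho n.+1) (deltan rho delta n.+1) L' ->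
  exists L, sld_eq rho delta L.
Proof.
move=> pr r1 d0; have [M ->] := consmx_surj L'.
rewrite /sld_eq /hermitian_mx consmx_adj => -[/consmx_inj MH].
rewrite deltanS tpowS !consmxM consmxD consmxZ.
move=> /consmx_inj/(congr1 (@ptrace2 C d _)).
rewrite ptrace2Z !ptrace2D !ptrace2_kron mxtrace_tpow // mxtrace_deltan //.
rewrite scale1r scale0r addr0 ptrace2_right_mul ptrace2_left_mul => e.
(* The reduced matrix is Hermitian by cyclicity on the traced sites. *)
exists (ptrace2 (M *m kron 1%:M (tpow rho n))); split=> //.
rewrite -ptrace2_adj adjmxM adjmx_kron adjmx1 MH.
by rewrite (proj1 (psd_tpow n pr)) ptrace2_cyclic.
Qed.

Lemma tsum_moment1 rho A n : \tr rho = 1 -> \tr (rho *m A) = 0 ->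
  \tr (tpow rho n *m tsum A n) = 0.
Proof.
move=> r1 a0; elim: n => [|n IHn]; first by rewrite mulmx0 raddf0.
rewrite tpowS tsumS consmxM mxtrace_consmx bipartite_moment1 ?mxtrace_tpow //.
by rewrite a0 IHn addr0.
Qed.

Lemma tsum_moment2 rho A B n : \tr rho = 1 ->
    \tr (rho *m A) = 0 -> \tr (rho *m B) = 0 ->
  \tr (tpow rho n *m (tsum A n *m tsum B n)) = n%:R * \tr (rho *m (A *m B)).
Proof.
move=> r1 a0 b0; elim: n => [|n IHn]; first by rewrite !mulmx0 raddf0 mul0r.
rewrite tpowS !tsumS !consmxM mxtrace_consmx bipartite_moment2 ?mxtrace_tpow //.
by rewrite IHn -natr1 mulrDl mul1r addrC.
Qed.

(** Second moments are linear in [n], so the fourth moment obeys [M4 (n + 1) = m + M4 n + n c] and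
    grows quadratically. *)
Lemma tsum_moment4 rho A1 A2 A3 A4 : \tr rho = 1 ->
    \tr (rho *m A1) = 0 -> \tr (rho *m A2) = 0 ->
    \tr (rho *m A3) = 0 -> \tr (rho *m A4) = 0 ->
  exists2 K : C, 0 <= K & forall n,
    `|\tr (tpow rho n *m (tsum A1 n *m tsum A2 n *m (tsum A3 n *m tsum A4 n)))|
    <= K * n%:R ^+ 2.
Proof.
move=> r1 a1 a2 a3 a4.
pose E A B := \tr (rho *m (A *m B)).
pose m := \tr (rho *m (A1 *m A2 *m (A3 *m A4))).
pose c := E A1 A2 * E A3 A4 + E A1 A3 * E A2 A4 + E A1 A4 * E A2 A3
  + E A2 A3 * E A1 A4 + E A2 A4 * E A1 A3 + E A3 A4 * E A1 A2.
(* For [K = |m| + |c|], the increment [K (2 n + 1)] of [K n^2] dominates [|m| + n |c|]. *)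
exists (`|m| + `|c|); first by rewrite addr_ge0.
elim=> [|n IHn]; first by rewrite !mulmx0 raddf0 normr0 expr0n mulr0.
rewrite tpowS !tsumS !consmxM mxtrace_consmx bipartite_moment4 ?mxtrace_tpow //;
  try exact: tsum_moment1.
rewrite !tsum_moment2 // -/m -/(E _ _).
set M4 := \tr _ in IHn *; set S := (X in m + M4 + X).
have -> : S = n%:R * c by rewrite /S /c /E; ring.
apply: le_trans (ler_normD _ _) _; apply: le_trans (lerD (ler_normD _ _) (lexx _)) _.
rewrite normrM normr_nat.
have -> : (`|m| + `|c|) * n.+1%:R ^+ 2 = `|m| + (`|m| + `|c|) * n%:R ^+ 2 +
    n%:R * `|c| + (`|c| + n%:R * (`|c| + 2 * `|m|)).
  by rewrite -natr1; ring.
rewrite -[leLHS]addr0; apply: lerD; first by rewrite lerD2r lerD2l.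
by rewrite addr_ge0 ?mulr_ge0 ?addr_ge0 ?mulr_ge0.
Qed.

End TensorSums.

(** * Choice of the scale and the common limit argument *)

Section Asymptotics.
Variable C : numClosedFieldType.

(** Taking [c] of order [sqrt n] makes each of the three terms at most [n eps / 3]. *)
Lemma eventually_small_excess (K : C) (t r : nat -> C) : 0 <= K ->
    (forall n, 0 <= t n) -> (forall n, 0 <= r n) ->
    conv0 r -> conv0 (fun n => (sqrtC n%:R)^-1 * t n) ->
  forall eps : C, 0 < eps -> exists N, forall n, (N <= n)%N -> (0 < n)%N /\
    forall z, (forall c, 0 < c -> z <= 2 * c * t n + c ^+ 2 * r n
                                  + (16 * c ^+ 2)^-1 * (K * n%:R ^+ 2)) ->
    z <= n%:R * eps.
Proof.
move=> K0 t0 r0 cr ct eps e0.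
(* [c = b * sqrt n], with [b] large enough to absorb the fourth moment. *)
pose b := 1 + 3 * K / eps.
have b1 : 1 <= b by rewrite lerDl divr_ge0 ?mulr_ge0 // ltW.
have b0 : 0 < b := lt_le_trans ltr01 b1.
(* The tolerances are those for which [c^2 r] and [2 c t], with [c = b sqrt n], come to
   [n eps / 3]. *)
have [N1 HN1] := cr _ (divr_gt0 e0 (mulr_gt0 (ltr0n C 3) (exprn_gt0 2 b0))).
have [N2 HN2] := ct _ (divr_gt0 e0 (mulr_gt0 (ltr0n C 6) b0)).
exists (maxn 1 (maxn N1 N2)) => n; rewrite !geq_max => /and3P[n0 n1 n2].
split=> // z Hz; pose q := sqrtC n%:R : C.
have q0 : 0 < q by rewrite sqrtC_gt0 ltr0n.
have qq : n%:R = q ^+ 2 by rewrite sqrtCK.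
have {}HN1 := HN1 n n1; have {}HN2 := HN2 n n2.
rewrite ger0_norm // in HN1.
rewrite ger0_norm ?mulr_ge0 ?invr_ge0 ?(ltW q0) // -/q mulrC ler_pdivrMr // in HN2.
apply: le_trans (Hz _ (mulr_gt0 b0 q0)) _; rewrite qq.
have -> : q ^+ 2 * eps = q ^+ 2 * (eps / 3) + q ^+ 2 * (eps / 3) + q ^+ 2 * (eps / 3).
  by field.
apply: lerD; first apply: lerD.
- have -> : q ^+ 2 * (eps / 3) = 2 * (b * q) * (eps / (6 * b) * q).
    by field; rewrite gt_eqF.
  by rewrite ler_pM2l // !mulr_gt0.
- have -> : q ^+ 2 * (eps / 3) = (b * q) ^+ 2 * (eps / (3 * b ^+ 2)).
    by field; rewrite gt_eqF.
  by rewrite ler_pM2l // exprn_gt0 // mulr_gt0.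
have -> : (16 * (b * q) ^+ 2)^-1 * (K * q ^+ 2 ^+ 2) = q ^+ 2 * (K / (16 * b ^+ 2)).
  by field; rewrite !gt_eqF.
rewrite ler_pM2l ?exprn_gt0 // ler_pdivrMr ?mulr_gt0 ?exprn_gt0 ?ltr0n //.
(* The summand [3 K / eps] of [b] gives [K <= b eps / 3], and [b >= 1] gives [b <= 16 b^2]. *)
have Kb : K <= eps / 3 * b.
  have -> : eps / 3 * b = eps / 3 + K by rewrite /b; field; rewrite gt_eqF.
  by rewrite lerDr divr_ge0 // ltW.
apply: le_trans Kb _; rewrite ler_pM2l ?divr_gt0 ?ltr0n //.
rewrite expr2 mulrA -{1}[b]mul1r ler_pM2r // (le_trans b1) //.
by rewrite -{1}[b]mul1r ler_pM2r // ler1n.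
Qed.

Variables (d : nat) (rho delta L : 'M[C]_d).
Variables (rho' delta' : forall n : nat, 'M[C]_(d ^ n)).
Hypotheses (rho_state : is_state rho) (delta_herm : traceless_herm delta).
Hypotheses (rho'_state : forall n, is_state (rho' n))
           (delta'_herm : forall n, traceless_herm (delta' n)).
Hypotheses (rho'_cvg : conv0 (fun n => trnorm (rho' n - tpow rho n)))
  (delta'_cvg : conv0 (fun n => (sqrtC (n%:R : C))^-1 *
                                trnorm (delta' n - deltan rho delta n))).

(** The class [P] of test matrices and the values [x], [y] stay abstract, so that one argument
    serves both informations. Centring is asked of [L] and of [L^H], since both enter the fourth
    moment. *)
Lemma liminf_score (P : forall m, 'M[C]_m -> Prop) (x y : nat -> option C) :
    \tr (rho *m L) = 0 -> \tr (rho *m L^H) = 0 ->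
    (forall n a, 0 < a -> P _ (trunc a (tsum L n))) ->
    (forall n, score (@P _) (tpow rho n) (deltan rho delta n) (tsum L n)) ->
    (forall n z, x n = Some z -> exists2 L', score (@P _) (rho' n) (delta' n) L'
        & z = \tr (L' *m rho' n *m L'^H)) ->
    (forall n z, y n = Some z -> exists2 L',
        score (@P _) (tpow rho n) (deltan rho delta n) L'
        & z = \tr (L' *m tpow rho n *m L'^H)) ->
  liminf_diff_ge0 x y.
Proof.
move=> l0 l0' PX sL xS yS eps e0; have [pr r1] := rho_state.
have [K K0 HK] := tsum_moment4 r1 l0' l0 l0' l0.
have [N HN] := eventually_small_excess K0 (fun n => trnorm_ge0 _)
  (fun n => trnorm_ge0 _) rho'_cvg delta'_cvg e0.
exists N => n /HN[n0 {}HN].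
case yE: (y n) => [v|//]; case xE: (x n) => [u|//].
have [L1 s1 ->] := xS _ _ xE; have [L2 s2 ->] := yS _ _ yE.
(* The derivative behind [y n] is traded for the explicit [tsum L n], whose moments are known. *)
rewrite (score_unique s2 (sL n)) ler_pdivlMr ?ltr0n // mulNr lerNl opprB mulrC.
apply: HN => c c0.
apply: le_trans (score_perturb (PX n) c0 (psd_tpow n pr) (proj1 (rho'_state n))
  (hermitian_deltan n pr (proj1 delta_herm)) (proj1 (delta'_herm n)) (sL n) s1) _.
rewrite lerD2l ler_pM2l ?invr_gt0 ?mulr_gt0 ?exprn_gt0 ?ltr0n //.
(* The moment equals its conjugate, so it is real and at most its modulus. *)
apply: le_trans (HK n); rewrite tsum_adj; apply: real_ler_norm.
apply/CrealP; rewrite -mxtrace_adj !adjmxM !tsum_adj adjmxK.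
by rewrite (proj1 (psd_tpow n pr)) mxtrace_mulC.
Qed.

End Asymptotics.

(** * The symmetric case, then the right one, each split on whether [delta] has a derivative *)

Theorem mainTheorem15 (C : archiClosedFieldType) (d : nat)
  (rho delta : 'M[C]_d) (rho' delta' : forall n : nat, 'M[C]_(d ^ n)) :
  is_state rho ->
  traceless_herm delta ->
  (forall n, is_state (rho' n)) ->
  (forall n, traceless_herm (delta' n)) ->
  conv0 (fun n => trnorm (rho' n - tpow rho n)) ->
  conv0 (fun n => (sqrtC (n%:R : C))^-1 * trnorm (delta' n - deltan rho delta n)) ->
  liminf_diff_ge0 (fun n => JS (rho' n) (delta' n))
                  (fun n => JS (tpow rho n) (deltan rho delta n)) /\
  liminf_diff_ge0 (fun n => JR (rho' n) (delta' n))
                  (fun n => JR (tpow rho n) (deltan rho delta n)).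
Proof.
move=> rs dh rs' dh' cr cd; have [[pr r1] [dH d0]] := (rs, dh).
split.
  have [[L sL]|nL] := excluded_middle_informative (exists L, sld_eq rho delta L).
    (* The trace of the symmetric equation reads [tr delta = tr (rho L)]. *)
    have l0 : \tr (rho *m L) = 0.
      move: d0; rewrite (proj2 sL) mxtraceZ raddfD /= [\tr (L *m _)]mxtrace_mulC.
      by move: (\tr _) => u <-; field.
    apply: (liminf_score (L := L) rs dh rs' dh' cr cd
              (P := fun m => @hermitian_mx C m)) => //.
    - by rewrite (proj1 sL).
    - by move=> n a a0; apply: trunc_herm; rewrite // /hermitian_mx tsum_adj (proj1 sL).
    - by move=> n; apply/sld_score/sld_tsum.
    - by move=> n z /JS_some[L' [/sld_score]]; exists L'.
    - by move=> n z /JS_some[L' [/sld_score]]; exists L'.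
  (* Without a derivative of [delta] the unperturbed information is infinite for every [n >= 1], and
     nothing is to be shown. At [n = 0] it is finite, [deltan] being zero there. *)
  move=> eps _; exists 1%N => -[//|n] _.
  case e: (JS (tpow _ _) _) => [z|//]; have [L' [sL' _]] := JS_some e.
  by case: nL; apply: sld_of_tensor sL'.
have [[L sL]|nL] := excluded_middle_informative (exists L, delta = L *m rho).
  have l0 : \tr (rho *m L) = 0 by rewrite mxtrace_mulC -sL.
  apply: (liminf_score (L := L) rs dh rs' dh' cr cd (P := fun=> fun=> True)) => //.
  (* [tr (rho L^H)] is the conjugate of [tr (L rho) = tr delta]. *)
  - by rewrite -{1}(proj1 pr) -adjmxM mxtrace_adj -sL d0 rmorph0.
  - move=> n; apply: rld_score; first exact: (proj1 (psd_tpow n pr)).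
      exact: hermitian_deltan.
    exact: rld_tsum.
  - move=> n z /JR_some[L' [e ->]]; exists L' => //; apply: rld_score => //.
      exact: (proj1 (proj1 (rs' n))).
    exact: (proj1 (dh' n)).
  - move=> n z /JR_some[L' [e ->]]; exists L' => //; apply: rld_score => //.
      exact: (proj1 (psd_tpow n pr)).
    exact: hermitian_deltan.
move=> eps _; exists 1%N => -[//|n] _.
case e: (JR (tpow _ _) _) => [z|//]; have [L' [sL' _]] := JR_some e.
by case: nL; apply: rld_of_tensor sL'.
Qed.
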